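(* Let $n\ge 2$. For every $i\in\{1,\dots,n\}$, every finite multiset $\Gamma$ of formulas of the $n$-dimensional propositional calculus $n$PC and every formula $F$ of $n$PC, we have $\Gamma\models_i F$ if and only if the sequent $\Gamma\vdash_i F$ is provable in $n$PC.
   Context: Fix $n\ge 2$, write $\hat n=\{1,\dots,n\}$, let $S_n$ be the group of permutations of $\hat n$ and $V$ a countable set of propositional variables. Formulas of $n$PC are: decorated variables $X^\pi$ ($X\in V$, $\pi\in S_n$); constants $\mathsf e_1,\dots,\mathsf e_n$; compound formulas $q(F,G_1,\dots,G_n)$ with $F,G_1,\dots,G_n$ formulas. For $\rho\in S_n$, $F^\rho$ is defined by $(X^\pi)^\rho=X^{\rho\circ\pi}$, $(\mathsf e_k)^\rho=\mathsf e_{\rho(k)}$, $q(F,G_1,\dots,G_n)^\rho=q(F,G_1^\rho,\dots,G_n^\rho)$ (the first argument is unchanged). $(ij)$ denotes the transposition exchanging $i$ and $j$ (the identity if $i=j$). Contexts $\Gamma,\Delta$ are finite multisets of formulas, $\Gamma^\rho$ is applied elementwise. A sequent is $\Gamma\vdash_i\Delta$ with $i\in\hat n$; it is provable if derivable with the following rules (premises $\Rightarrow$ conclusion), for all $i,j,k\in\hat n$: (Const) $\Rightarrow\ \vdash_i\mathsf e_i$. (Id) $\Rightarrow X^\pi\vdash_i X^\rho$ whenever $\pi^{-1}(i)=\rho^{-1}(i)$. (Sym) $\Gamma^{(ij)}\vdash_i\Delta^{(ij)}\Rightarrow\Gamma\vdash_j\Delta$. (Neg1) if $i\ne k$: $\Gamma^{(ij)}\vdash_i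 F,\Delta^{(ij)}\Rightarrow \Gamma,F^{(jk)}\vdash_j\Delta$. (Neg2) if $j\neq k$: $\Gamma^{(ij)}\vdash_i F,\Delta^{(ij)}\Rightarrow \Gamma,F^{(ik)}\vdash_j\Delta$. (Neg3) $\{\Gamma^{(ij)},F\vdash_i\Delta^{(ij)}\}_{i\neq j}\Rightarrow\Gamma\vdash_j F,\Delta$. (qL) $\{\Gamma^{(ji)},F,G_j^{(ji)}\vdash_j\Delta^{(ji)}\}_{j\in\hat n}\Rightarrow \Gamma,q(F,G_1,\dots,G_n)\vdash_i\Delta$. (qR) $\{\Gamma^{(ji)},F\vdash_j G_j^{(ji)},\Delta^{(ji)}\}_{j\in\hat n}\Rightarrow\Gamma\vdash_i q(F,G_1,\dots,G_n),\Delta$. (Cut) $\Gamma,F\vdash_i\Delta$ and $\Gamma\vdash_i F,\Delta\Rightarrow\Gamma\vdash_i\Delta$. Left and right weakening and contraction in each $\vdash_i$. Semantics: an environment is a function $v:V\to\hat n$; $[\![X^\pi]\!]_v=\pi(v(X))$, $[\![\mathsf e_i]\!]_v=i$, $[\![q(F,G_1,\dots,G_n)]\!]_v=[\![G_k]\!]_v$ where $k=[\![F]\!]_v$. $\Gamma\models_i\Delta$ means: for every environment $v$, if $[\![G]\!]_v=i$ for all $G\in\Gamma$ then $[\![F]\!]_v=i$ for some $F\in\Delta$. *)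

(* Defs.v *)
From HB Require Import structures.
From mathcomp Require Import all_boot all_fingroup finmap multiset.

Set Implicit Arguments.
Unset Strict Implicit.
Unset Printing Implicit Defensive.

Local Open Scope mset_scope.

(* The set {1, .., n} is represented by 'I_n. *)

Unset Elimination Schemes.
Inductive formula (n : nat) (V : Type) : Type :=
| FVar of V & {perm 'I_n}
| FConst of 'I_n
| FQ of formula n V & {ffun 'I_n -> formula n V}.
Set Elimination Schemes.

Arguments FVar {n V}.
Arguments FConst {n V}.
Arguments FQ {n V}.

Definition formula_rect (n : nat) (V : Type) (P : formula n V -> Type)
    (PVar : forall X pi, P (FVar X pi)) (PConst : forall k, P (FConst k))
    (PQ : forall F (G : {ffun 'I_n -> formula n V}),
      P F -> (forall k, P (G k)) -> P (FQ F G)) :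
  forall F, P F :=
  fix loop F : P F :=
    match F with
    | FVar X pi => PVar X pi
    | FConst k => PConst k
    | FQ F G => PQ F G (loop F) (fun k => loop (G k))
    end.

Definition formula_ind (n : nat) (V : Type) (P : formula n V -> Prop) :=
  @formula_rect n V P.

(* {mset T} requires T to be a choiceType; formulas are encoded as generic trees. *)
Section FormulaCountable.
Variables (n : nat) (V : countType).

Fixpoint formula_encode (F : formula n V) :
    GenTree.tree (V * {perm 'I_n} + 'I_n) :=
  match F with
  | FVar X pi => GenTree.Leaf (inl (X, pi))
  | FConst k => GenTree.Leaf (inr k)
  | FQ F G => GenTree.Node 0
      (formula_encode F :: [seq formula_encode (G k) | k <- enum 'I_n])
  end.

Fixpoint formula_decode (t : GenTree.tree (V * {perm 'I_n} + 'I_n)) :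
    option (formula n V) :=
  match t with
  | GenTree.Leaf (inl (X, pi)) => Some (FVar X pi)
  | GenTree.Leaf (inr k) => Some (FConst k)
  | GenTree.Node _ ts =>
      if pmap id [seq formula_decode u | u <- ts] is F :: s
      then Some (FQ F [ffun k : 'I_n => nth F s k])
      else None
  end.

Lemma formula_encodeK : pcancel formula_encode formula_decode.
Proof.
elim=> [X pi|k|F G IHF IHG] //=; rewrite IHF /=.
have -> s : pmap id
    [seq formula_decode u | u <- [seq formula_encode (G k) | k <- s]] =
    [seq G k | k <- s] by elim: s => //= k s ->; rewrite IHG.
congr (Some (FQ F _)); apply/ffunP => k; rewrite ffunE.
by rewrite (nth_map k) ?size_enum_ord // nth_ord_enum.
Qed.

HB.instance Definition _ :=
  Countable.copy (formula n V) (pcan_type formula_encodeK).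
End FormulaCountable.

(* (pi * rho)%g x = rho (pi x), so pi * rho is the composite rho \o pi. *)
Fixpoint ren (n : nat) (V : Type) (rho : {perm 'I_n}) (F : formula n V) :
    formula n V :=
  match F with
  | FVar X pi => FVar X (pi * rho)%g
  | FConst k => FConst (rho k)
  | FQ F G => FQ F [ffun k => ren rho (G k)]
  end.

Definition mren (n : nat) (V : countType) (rho : {perm 'I_n})
    (Gamma : {mset formula n V}) : {mset formula n V} :=
  seq_mset [seq ren rho F | F <- enum_mset Gamma].

Fixpoint sem (n : nat) (V : Type) (v : V -> 'I_n) (F : formula n V) : 'I_n :=
  match F with
  | FVar X pi => pi (v X)
  | FConst k => k
  | FQ F G => sem v (G (sem v F))
  end.

Definition entails (n : nat) (V : countType) (i : 'I_n)
    (Gamma Delta : {mset formula n V}) : Prop :=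
  forall v : V -> 'I_n,
    (forall G, G \in Gamma -> sem v G = i) ->
    exists2 F, F \in Delta & sem v F = i.

Reserved Notation "Gamma |-[ i ] Delta" (at level 70, i at level 50).

(* tperm i j is the identity permutation when i = j. *)
Inductive provable (n : nat) (V : countType) :
    'I_n -> {mset formula n V} -> {mset formula n V} -> Prop :=
| r_const i : mset0 |-[i] [mset FConst i]
| r_id i X (pi rho : {perm 'I_n}) :
    (pi^-1)%g i = (rho^-1)%g i ->
    [mset FVar X pi] |-[i] [mset FVar X rho]
| r_sym i j Gamma Delta :
    mren (tperm i j) Gamma |-[i] mren (tperm i j) Delta ->
    Gamma |-[j] Delta
| r_neg1 i j k Gamma Delta F :
    i != k ->
    mren (tperm i j) Gamma |-[i] F +` mren (tperm i j) Delta ->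
    ren (tperm j k) F +` Gamma |-[j] Delta
| r_neg2 i j k Gamma Delta F :
    j != k ->
    mren (tperm i j) Gamma |-[i] F +` mren (tperm i j) Delta ->
    ren (tperm i k) F +` Gamma |-[j] Delta
| r_neg3 j Gamma Delta F :
    (forall i, i != j ->
      F +` mren (tperm i j) Gamma |-[i] mren (tperm i j) Delta) ->
    Gamma |-[j] F +` Delta
| r_qL i Gamma Delta F (G : {ffun 'I_n -> formula n V}) :
    (forall j,
      F +` (ren (tperm j i) (G j) +` mren (tperm j i) Gamma)
        |-[j] mren (tperm j i) Delta) ->
    FQ F G +` Gamma |-[i] Delta
| r_qR i Gamma Delta F (G : {ffun 'I_n -> formula n V}) :
    (forall j,
      F +` mren (tperm j i) Gamma
        |-[j] ren (tperm j i) (G j) +` mren (tperm j i) Delta) ->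
    Gamma |-[i] FQ F G +` Delta
| r_cut i Gamma Delta F :
    F +` Gamma |-[i] Delta ->
    Gamma |-[i] F +` Delta ->
    Gamma |-[i] Delta
| r_weakL i Gamma Delta F :
    Gamma |-[i] Delta -> F +` Gamma |-[i] Delta
| r_weakR i Gamma Delta F :
    Gamma |-[i] Delta -> Gamma |-[i] F +` Delta
| r_contrL i Gamma Delta F :
    F +` (F +` Gamma) |-[i] Delta -> F +` Gamma |-[i] Delta
| r_contrR i Gamma Delta F :
    Gamma |-[i] F +` (F +` Delta) -> Gamma |-[i] F +` Delta
where "Gamma |-[ i ] Delta" := (provable i Gamma Delta).

(* Main.v *)
(** Soundness is an induction on derivations.  Completeness follows Kalmar: relative to index [i],
    the formula [X^((v X) i)] on the left of a sequent asserts that the variable [X] has value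
    [v X].  Under such assertions for all variables of [F], the calculus proves [F^rho] whenever
    [rho] sends the value of [F] to [i], and refutes [F^rho] otherwise.  Neg3, Sym and Cut allow a
    case distinction over the [n] values of each variable, so proving the sequent under every
    assignment suffices. *)
Require Import Defs.
From mathcomp Require Import all_boot all_fingroup finmap multiset.

Set Implicit Arguments.
Unset Strict Implicit.
Unset Printing Implicit Defensive.

Local Open Scope mset_scope.

Lemma seq_mset_nil (K : choiceType) : seq_mset [::] = mset0 :> {mset K}.
Proof. by apply/msetP => x; rewrite mset_seqE mset0E. Qed.

(** * The action of permutations on formulas and contexts *)

Section Renaming.
Variable n : nat.

Lemma sem_ren (V : Type) (v : V -> 'I_n) (rho : {perm 'I_n}) (F : formula n V) :
  sem v (ren rho F) = rho (sem v F).
Proof. by elim: F => [X pi|k|F G _ IHG] //=; rewrite ?permM // ffunE IHG. Qed.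

Lemma ren_comp (V : Type) (rho sigma : {perm 'I_n}) (F : formula n V) :
  ren sigma (ren rho F) = ren (rho * sigma)%g F.
Proof.
elim: F => [X pi|k|F G _ IHG] /=; rewrite ?mulgA ?permM //.
by congr FQ; apply/ffunP => k; rewrite !ffunE IHG.
Qed.

Lemma ren_id (V : Type) (F : formula n V) : ren 1%g F = F.
Proof.
elim: F => [X pi|k|F G _ IHG] /=; rewrite ?mulg1 ?perm1 //.
by congr FQ; apply/ffunP => k; rewrite !ffunE IHG.
Qed.

Variable V : countType.
Implicit Types (Gamma Delta : {mset formula n V}) (F : formula n V).

Lemma in_mren (rho : {perm 'I_n}) Gamma F :
  (F \in mren rho Gamma) = (ren (rho^-1)%g F \in Gamma).
Proof.
rewrite in_mset mset_seqE -has_count has_pred1; apply/mapP/idP => [[G GG ->]|GG].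
  by rewrite ren_comp mulgV ren_id.
by exists (ren (rho^-1)%g F) => //; rewrite ren_comp mulVg ren_id.
Qed.

Lemma mrenD1 (rho : {perm 'I_n}) Gamma F :
  mren rho (F +` Gamma) = ren rho F +` mren rho Gamma.
Proof.
rewrite /mren -mset_cons -map_cons; apply/eq_seq_msetP/perm_map.
by rewrite -[X in F +` X]seq_mset_id -mset_cons perm_eq_seq_mset.
Qed.

Lemma mren_comp (rho sigma : {perm 'I_n}) Gamma :
  mren sigma (mren rho Gamma) = mren (rho * sigma)%g Gamma.
Proof.
rewrite /mren; apply/eq_seq_msetP.
rewrite (perm_trans (perm_map _ (perm_eq_seq_mset _))) // -map_comp.
by rewrite (eq_map (ren_comp rho sigma)).
Qed.

Lemma mren_id Gamma : mren 1%g Gamma = Gamma.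
Proof. by rewrite /mren (eq_map (@ren_id V)) map_id seq_mset_id. Qed.

Lemma ren_tpermK (i j : 'I_n) : involutive (@ren n V (tperm i j)).
Proof. by move=> F; rewrite ren_comp tperm2 ren_id. Qed.

Lemma mren_tpermK (i j : 'I_n) : involutive (@mren n V (tperm i j)).
Proof. by move=> Gamma; rewrite mren_comp tperm2 mren_id. Qed.

Lemma mem_mren (rho : {perm 'I_n}) Gamma F :
  F \in Gamma -> ren rho F \in mren rho Gamma.
Proof. by move=> FG; rewrite in_mren ren_comp mulgV ren_id. Qed.

End Renaming.

(** * Soundness, rule by rule *)

Section Soundness.
Variables (n : nat) (V : countType).
Implicit Types (Gamma Delta : {mset formula n V}) (F : formula n V) (v : V -> 'I_n).

Lemma tperm_eqL (T : finType) (x y z : T) : tperm x y z = x -> z = y.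
Proof. by move=> xyz; rewrite -[z](tpermK x y) xyz tpermL. Qed.

(** The transposition carries value [j] to [i], so assumptions that hold at index [j] hold at index
    [i] after renaming. *)
Lemma all_sem_mren v i j Gamma :
  (forall G, G \in Gamma -> sem v G = j) ->
  forall G, G \in mren (tperm i j) Gamma -> sem v G = i.
Proof.
move=> GammaP G; rewrite in_mren => /GammaP.
by rewrite sem_ren tpermV tpermC => /tperm_eqL.
Qed.

Lemma ex_sem_mren v i j Delta :
  (exists2 G, G \in mren (tperm i j) Delta & sem v G = i) ->
  exists2 G, G \in Delta & sem v G = j.
Proof.
case=> G; rewrite in_mren tpermV => GD Gi.
by exists (ren (tperm i j) G); rewrite // sem_ren Gi tpermL.
Qed.

Lemma all_semD1 v i F Gamma :
  (forall G, G \in F +` Gamma -> sem v G = i) <->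
  sem v F = i /\ (forall G, G \in Gamma -> sem v G = i).
Proof.
split=> [FGP|[FP GP] G]; last by rewrite in_mset1D => /predU1P[->|/GP].
by split=> [|G GG]; apply: FGP; rewrite in_mset1D ?eqxx ?GG ?orbT.
Qed.

Lemma ex_semD1 v i F Delta :
  (exists2 G, G \in F +` Delta & sem v G = i) <->
  sem v F = i \/ (exists2 G, G \in Delta & sem v G = i).
Proof.
split=> [[G]|[FP|[G GD GP]]].
- by rewrite in_mset1D => /predU1P[->|GD GP]; [left | right; exists G].
- by exists F; rewrite // in_mset1D eqxx.
- by exists G; rewrite // in_mset1D GD orbT.
Qed.

Lemma provable_sound i Gamma Delta : Gamma |-[i] Delta -> entails i Gamma Delta.
Proof.
elim=> {i Gamma Delta}.
- by move=> i v _; exists (FConst i); rewrite ?in_mset1.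
- move=> i X pi rho pirho v /(_ (FVar X pi)); rewrite in_mset1 eqxx => /(_ isT) /= piX.
  by exists (FVar X rho); rewrite ?in_mset1 //= -[v X](permK pi) piX pirho permKV.
- by move=> i j Gamma Delta _ IH v /(all_sem_mren (i := i)) /IH /ex_sem_mren.
- move=> i j k Gamma Delta F ik _ IH v /all_semD1[].
  rewrite sem_ren => /tperm_eqL Fk.
  move=> /(all_sem_mren (i := i)) /IH /ex_semD1[Fi|/ex_sem_mren //].
  by rewrite -Fi Fk eqxx in ik.
- move=> i j k Gamma Delta F jk _ IH v /all_semD1[].
  rewrite sem_ren => FP /(all_sem_mren (i := i)) /IH /ex_semD1[Fi|/ex_sem_mren //].
  by move: jk; rewrite -FP Fi tpermL eqxx.
- move=> j Gamma Delta F _ IH v GP; apply/ex_semD1.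
  have [->|Fj] := eqVneq (sem v F) j; [by left | right].
  (* Of the premises of Neg3, the one indexed by the actual value of [F] applies. *)
  apply: (@ex_sem_mren v (sem v F)); apply: (IH _ Fj).
  by apply/all_semD1; split=> //; apply: all_sem_mren.
- move=> i Gamma Delta F G _ IH v /all_semD1[/= GFi GP].
  (* The value of [F] selects both the branch of the compound formula and the premise of the
     rule. *)
  apply: (@ex_sem_mren v (sem v F)); apply: IH.
  apply/all_semD1; split=> //; apply/all_semD1.
  by split; [rewrite sem_ren GFi tpermR | apply: all_sem_mren].
- move=> i Gamma Delta F G _ IH v GP; apply/ex_semD1 => /=.
  have /ex_semD1 : exists2 H, H \in ren (tperm (sem v F) i) (G (sem v F)) +`
      mren (tperm (sem v F) i) Delta & sem v H = sem v F.
    by apply: IH; apply/all_semD1; split=> //; apply: all_sem_mren.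
  case=> [|/ex_sem_mren]; last by right.
  by rewrite sem_ren => /tperm_eqL; left.
- move=> i Gamma Delta F _ IHL _ IHR v GP.
  by have /ex_semD1[FP|//] := IHR v GP; apply: IHL; apply/all_semD1.
- by move=> i Gamma Delta F _ IH v /all_semD1[_ /IH].
- by move=> i Gamma Delta F _ IH v /IH DP; apply/ex_semD1; right.
- move=> i Gamma Delta F _ IH v FGP; apply: IH; apply/all_semD1; split=> //.
  by case/all_semD1: FGP.
- by move=> i Gamma Delta F _ IH v /IH /ex_semD1[FP|//]; apply/ex_semD1; left.
Qed.

End Soundness.

(** * Completeness by Kalmar's method *)

Section Completeness.
Variables (n : nat) (V : countType).
Implicit Types (Gamma Delta : {mset formula n V}) (F : formula n V) (v : V -> 'I_n).

Lemma provable_weakenL i Gamma Gamma' Delta :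
  Gamma |-[i] Delta -> Gamma' `+` Gamma |-[i] Delta.
Proof.
move=> GD; rewrite -(seq_mset_id Gamma'); elim: (enum_mset Gamma') => [|F s IHs].
  by rewrite seq_mset_nil mset0D.
by rewrite mset_cons -msetDA; apply: r_weakL.
Qed.

Lemma provable_weakenR i Gamma Delta Delta' :
  Gamma |-[i] Delta -> Gamma |-[i] Delta' `+` Delta.
Proof.
move=> GD; rewrite -(seq_mset_id Delta'); elim: (enum_mset Delta') => [|F s IHs].
  by rewrite seq_mset_nil mset0D.
by rewrite mset_cons -msetDA; apply: r_weakR.
Qed.

Lemma provable_contract_mem i Gamma Delta F :
  F \in Gamma -> F +` Gamma |-[i] Delta -> Gamma |-[i] Delta.
Proof. by move=> /msetB1K <-; apply: r_contrL. Qed.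

Lemma provable_sym i j Gamma Delta :
  Gamma |-[i] Delta -> mren (tperm i j) Gamma |-[j] mren (tperm i j) Delta.
Proof. by move=> GD; apply: (@r_sym _ _ i); rewrite !mren_tpermK. Qed.

(** At index [i], the formula [ren (tperm k i) F] asserts that [F] has value [k], so this is a case
    distinction over the values of [F]. Cut on [F] separates the case [k = i]; Neg3 and Sym treat
    the others. *)
Lemma provable_cases i Gamma Delta F :
  (forall k, ren (tperm k i) F +` Gamma |-[i] Delta) -> Gamma |-[i] Delta.
Proof.
move=> FP; apply: (@r_cut _ _ _ _ _ F); first by move: (FP i); rewrite tperm1 ren_id.
apply: r_neg3 => k _; have := provable_sym k (FP k).
by rewrite mrenD1 (tpermC i k) ren_tpermK.
Qed.

Fixpoint vars (W : Type) (F : formula n W) : seq W :=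
  match F with
  | FVar X _ => [:: X]
  | FConst _ => [::]
  | FQ F G => vars F ++ flatten [seq vars (G k) | k <- enum 'I_n]
  end.

Lemma vars_branch F (G : {ffun 'I_n -> formula n V}) k : {subset vars (G k) <= vars (FQ F G)}.
Proof.
move=> X XG; rewrite /= mem_cat; apply/orP; right.
by apply/flatten_mapP; exists k; rewrite ?mem_enum.
Qed.

(** At index [i], [FVar X tau] asserts that [X] has value [v X]. Any such [tau] is allowed, so that
    the property survives renaming of the context. *)
Definition fixes_vars v (s : seq V) i Gamma :=
  forall X, X \in s -> exists2 tau : {perm 'I_n}, tau (v X) = i & FVar X tau \in Gamma.

Lemma fixes_vars_mren v s i j Gamma :
  fixes_vars v s i Gamma -> fixes_vars v s j (mren (tperm j i) Gamma).
Proof.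
move=> sG X /sG[tau tauX XG]; exists (tau * tperm j i)%g; first by rewrite permM tauX tpermR.
exact: (mem_mren (tperm j i) XG).
Qed.

Lemma fixes_vars_sub v s s' i Gamma :
  {subset s' <= s} -> fixes_vars v s i Gamma -> fixes_vars v s' i Gamma.
Proof. by move=> ss' sG X /ss' /sG. Qed.

(** Induction on [F] with index, permutation and contexts general, since qR changes the index and
    renames the contexts. *)
Lemma provable_value v F i (rho : {perm 'I_n}) Gamma Delta :
  fixes_vars v (vars F) i Gamma -> rho (sem v F) = i -> Gamma |-[i] ren rho F +` Delta.
Proof.
elim: F i rho Gamma Delta => [X pi|k|F G IHF IHG] i rho Gamma Delta fixG /= rhoF.
- have [|tau tauX XG] := fixG X; first by rewrite mem_seq1.
  rewrite msetDC -(msetB1K XG) (msetDC [mset FVar X tau]).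
  apply/provable_weakenR/provable_weakenL/r_id.
  (* The side condition of Id holds because both decorations send [v X] to [i]. *)
  have -> : (tau^-1)%g i = v X by rewrite -tauX permK.
  by rewrite -rhoF -(permM pi) permK.
- rewrite msetDC -(msetD0 Gamma) rhoF.
  exact/provable_weakenR/provable_weakenL/r_const.
apply: r_qR => j; rewrite ffunE.
have fixj := fixes_vars_mren j fixG.
have fixF : fixes_vars v (vars F) j (mren (tperm j i) Gamma).
  by apply: fixes_vars_sub fixj => X XF /=; rewrite mem_cat XF.
(* If [j] is the value of [F], the branch [G j] is provable by induction; otherwise the assumption
   [F] is refutable at index [j]. *)
have [Fj|Fj] := eqVneq (sem v F) j.
  apply: r_weakL; rewrite ren_comp; apply: IHG.
    exact: fixes_vars_sub (@vars_branch F G j) fixj.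
  by rewrite permM -Fj rhoF tpermR.
(* Neg1 with [k = j], where the transposition is trivial, moves [F] to the right at the index that
   is its own value; there it is provable. *)
rewrite -[F]ren_id -(tperm1 j); apply: (r_neg1 (i := sem v F)) => //.
rewrite -[X in X +` _]ren_id; apply: IHF; last by rewrite perm1.
exact: fixes_vars_mren.
Qed.

Lemma provable_refute v F i Gamma Delta :
  fixes_vars v (vars F) i Gamma -> sem v F != i -> F +` Gamma |-[i] Delta.
Proof.
move=> fixG Fi; rewrite -[F]ren_id -(tperm1 i); apply: (r_neg1 (i := sem v F)) => //.
rewrite -[X in X +` _]ren_id; apply: (@provable_value v); last by rewrite perm1.
exact: fixes_vars_mren.
Qed.

(** The values of the variables in [s] are split one at a time, each split adding an assertion to
    the context. *)
Lemma provable_all_assignments (s : seq V) i Gamma Delta :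
  (forall v Gamma', {subset Gamma <= Gamma'} -> fixes_vars v s i Gamma' ->
    Gamma' |-[i] Delta) ->
  Gamma |-[i] Delta.
Proof.
(* With no variable to fix, any assignment will do. *)
elim: s Gamma => [|X s IHs] Gamma GD; first by apply: (GD (fun=> i)).
apply: (@provable_cases _ _ _ (FVar X 1%g)) => k; rewrite /= mul1g.
apply: IHs => v Gamma' sub fixs.
(* The override at [X] also covers the case where [X] occurs again in [s]. *)
apply: (GD (fun Y => if Y == X then k else v Y)) => [F FG|Y].
  by apply: sub; rewrite in_mset1D FG orbT.
rewrite inE; case: eqVneq => [-> _|_ /fixs //].
by exists (tperm k i); rewrite ?tpermL // sub // in_mset1D eqxx.
Qed.

Lemma provable_complete i Gamma F :
  entails i Gamma [mset F] -> Gamma |-[i] [mset F].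
Proof.
move=> GF; apply: (@provable_all_assignments
  (vars F ++ flatten [seq vars G | G <- enum_mset Gamma])) => v Gamma' sub fixs.
(* Either [v] satisfies [Gamma], so [F] has value [i] and is provable, or some member of [Gamma] has
   another value and is refutable. *)
have [|/allPn[G GG Gi]] := boolP (all (fun G => sem v G == i) (enum_mset Gamma)).
  move=> /allP GP; have [G /GP/eqP //|H] := GF v.
  rewrite in_mset1 => /eqP-> Fi.
  rewrite -(msetD0 [mset F]) -[F]ren_id; apply: (@provable_value v); last by rewrite perm1.
  by apply: fixes_vars_sub fixs => X XF; rewrite mem_cat XF.
(* Contraction supplies a copy of [G] to refute while [Gamma'] stays intact to fix the variables. *)
apply: (provable_contract_mem (sub _ GG)); apply: (@provable_refute v) => //.
apply: fixes_vars_sub fixs => X XG; rewrite mem_cat; apply/orP; right.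
by apply/flatten_mapP; exists G.
Qed.

End Completeness.

Unset Implicit Arguments.

Theorem theorem4p11 (n : nat) (hn : 2 <= n) (V : countType) (i : 'I_n)
    (Gamma : {mset formula n V}) (F : formula n V) :
  entails i Gamma [mset F] <-> provable i Gamma [mset F].
Proof. by split; [apply: provable_complete | apply: provable_sound]. Qed.
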